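(* Let $k\ge1$ and $0\le H\le k$ be integers and let $L=2^k\big/\sum_{i=0}^{H}\binom{k}{i}$. For every contract scheduling scheme in the noisy advice model with $k$ subset queries, at most $H$ of whose answers may be erroneous, the acceleration ratio is at least \[ \frac{1}{L}(1+L)^{1+1/L}. \]
   Context: A single-processor contract schedule is a strictly increasing sequence $X=(x_i)_{i\ge0}$ of positive reals, contracts run back to back from time $0$; for an interruption time $T$, $\ell(X,T)$ is the largest length of a contract completed by time $T$ (with $T/\ell=\infty$ if none). Noisy advice model: an adversary fixes an unknown interruption time $T>0$. Before execution, the scheduler adaptively asks $k$ yes/no subset queries about $T$, each of the form ''is $T\in S$?'' for a set $S\subseteq(0,\infty)$ of its choice; an adversary who knows $T$ answers them, and may answer at most $H$ of them incorrectly, where $H$ is known to the scheduler. Based on the $k$ answers the scheduler selects a single-processor schedule, which is then executed. Let $\mathcal X$ be the (finite) set of schedules the scheme can select and $T_0$ the maximum first contract length over $\mathcal X$. The acceleration ratio of the scheme is the supremum, over all $T\ge T_0$ and all answer sequences for $T$ with at most $H$ wrong answers, of $T/\ell(X,T)$ where $X$ is the selected schedule. *)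

(* Defs.v *)
From HB Require Import structures.
From mathcomp Require Import all_boot all_order all_algebra.
From mathcomp Require Import all_classical all_reals all_analysis.
Set Implicit Arguments.
Unset Strict Implicit.
Unset Printing Implicit Defensive.
Import Order.TTheory GRing.Theory Num.Theory.
Local Open Scope classical_set_scope.
Local Open Scope ring_scope.

Record schedule (R : realType) := Schedule {
  contract :> nat -> R ;
  contract_gt0 : forall i, 0 < contract i ;
  (* [increasing_seq] is strict monotonicity *)
  contract_incr : increasing_seq contract }.

(* Contracts run back to back from time 0, so contract i completes at time
   x_0 + ... + x_i, which is [series X i.+1]. *)
Definition completed_lengths (R : realType) (X : schedule R) (T : R) : set R :=
  [set X i | i in [set i | series X i.+1 <= T]].

(* When nonempty, [completed_lengths X T] is finite, so that this supremum is
   a maximum: see [largest_completedP]. *)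
Definition largest_completed (R : realType) (X : schedule R) (T : R) : R :=
  sup (completed_lengths X T).

Definition schedule_ratio (R : realType) (X : schedule R) (T : R) : \bar R :=
  if `[< completed_lengths X T !=set0 >] then (T / largest_completed X T)%:E
  else +oo%E.

(* [query p] is the set S of the question "is T in S?" asked once the answers
   [p] have been received (only the values at [size p < k] matter). *)
Record scheme (R : realType) (k : nat) := Scheme {
  query : seq bool -> set R ;
  query_gt0 : forall p, query p `<=` [set t | 0 < t] ;
  select : k.-tuple bool -> schedule R }.

Definition wrong_answers (R : realType) (k : nat) (A : scheme R k) (T : R)
    (a : k.-tuple bool) : nat :=
  #|[pred i : 'I_k | tnth a i != `[< query A (take i a) T >]]|.

Definition selectable (R : realType) (k H : nat) (A : scheme R k) :
    set (schedule R) :=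
  [set X | exists (T : R) (a : k.-tuple bool),
    [/\ 0 < T, (wrong_answers A T a <= H)%N & X = select A a]].

(* The schedules reached by some T > 0 and some admissible answers to T; this
   set is finite and nonempty, so that this supremum is a maximum: see
   [max_first_contractP]. *)
Definition max_first_contract (R : realType) (k H : nat) (A : scheme R k) : R :=
  sup [set (X : schedule R) 0%N | X in selectable H A].

Definition acceleration_ratio (R : realType) (k H : nat) (A : scheme R k) :
    \bar R :=
  ereal_sup [set r | exists (T : R) (a : k.-tuple bool),
    [/\ max_first_contract H A <= T, (wrong_answers A T a <= H)%N
      & r = schedule_ratio (select A a) T]].

Lemma largest_completedP (R : realType) (X : schedule R) (T : R) :
  completed_lengths X T !=set0 ->
  completed_lengths X T (largest_completed X T) /\
  (forall l, completed_lengths X T l -> l <= largest_completed X T).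
Proof.
move=> ne.
have X0 i : X 0%N <= X i by rewrite (contract_incr X).
have bnd i : series X i.+1 <= T -> (i <= Num.truncn (T / X 0%N))%N.
  move=> siT; have x0 := contract_gt0 X 0.
  have lin : X 0%N *+ i.+1 <= series X i.+1.
    rewrite /series /= big_mkord -[X in _ *+ X]card_ord -sumr_const.
    exact: ler_sum.
  have h : i.+1%:R <= T / X 0%N.
    by rewrite ler_pdivlMr// mulrC mulr_natr (le_trans lin).
  rewrite truncn_ge_nat ?(le_trans _ h)//.
  by rewrite ler_nat.
pose P i := `[< series X i.+1 <= T >].
have exP : exists i, P i by case: ne => _ [i /= siT _]; exists i; apply/asboolP.
have ubP i : P i -> (i <= Num.truncn (T / X 0%N))%N by move/asboolP; exact: bnd.
case: (ex_maxnP exP ubP) => m /asboolP Pm mmax.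
have Xm : completed_lengths X T (X m) by exists m.
have ub : ubound (completed_lengths X T) (X m).
  move=> _ [i /= siT <-]; rewrite (contract_incr X); apply: mmax.
  exact/asboolP.
suff -> : largest_completed X T = X m by split.
apply/le_anti/andP; split; first by apply: ge_sup => //; exists (X m).
by apply: ub_le_sup => //; exists (X m).
Qed.

Lemma selectable_nonempty (R : realType) (k H : nat) (A : scheme R k) :
  selectable H A !=set0.
Proof.
pose truth := fix truth n : seq bool := if n is n'.+1 then
  rcons (truth n') `[< query A (truth n') 1 >] else [::].
have sz n : size (truth n) = n by elim: n => //= n IHn; rewrite size_rcons IHn.
have tk n m : (n <= m)%N -> take n (truth m) = truth n.
  elim: m => [|m IHm]; first by rewrite leqn0 => /eqP ->.
  rewrite leq_eqVlt => /orP[/eqP -> |]; first by rewrite take_oversize// sz.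
  by rewrite ltnS /= => nm; rewrite -cats1 takel_cat ?sz// IHm.
have sk : size (truth k) == k by rewrite sz.
exists (select A (Tuple sk)), 1, (Tuple sk); split=> //.
rewrite /wrong_answers eq_card0// => i; rewrite !inE /=.
apply/negbTE/negPn/eqP; rewrite (tnth_nth false) /= tk; last exact/ltnW.
rewrite -[LHS](nth_take false (ltnSn i)) tk //=.
by rewrite nth_rcons sz ltnn eqxx.
Qed.

Lemma max_first_contractP (R : realType) (k H : nat) (A : scheme R k) :
  (exists2 X, selectable H A X & X 0%N = max_first_contract H A) /\
  (forall X, selectable H A X -> X 0%N <= max_first_contract H A).
Proof.
have [X0 [T0 [a0 [T0pos wa0 X0E]]]] := selectable_nonempty H A.
pose P a := `[< selectable H A (select A a) >].
have Pa0 : P a0 by apply/asboolP; exists T0, a0.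
case: (arg_maxP (fun a => select A a 0%N) Pa0) => m /asboolP selm ub.
have ubs : ubound [set (X : schedule R) 0%N | X in selectable H A]
    (select A m 0%N).
  move=> _ [X [T [a [Tpos wa ->]]] <-]; apply: ub; apply/asboolP.
  by exists T, a.
have -> : max_first_contract H A = select A m 0%N.
  apply/le_anti/andP; split.
    by apply: ge_sup => //; exists (select A m 0%N), (select A m).
  apply: ub_le_sup; first by exists (select A m 0%N).
  by exists (select A m).
split; first by exists (select A m).
by move=> X sX; apply: ubs; exists X.
Qed.

(* Main.v *)
Require Import Defs.
From HB Require Import structures.
From mathcomp Require Import all_boot all_order all_algebra.
From mathcomp Require Import all_classical all_reals all_analysis.
From mathcomp Require Import ring lra.
Import Order.TTheory GRing.Theory Num.Theory.
Local Open Scope classical_set_scope.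
Local Open Scope ring_scope.

(* Write S_i = x_0 + ... + x_i.  A schedule has ratio at most rho at T exactly
   when S_i <= T <= rho x_i for some i.  On the logarithmic scale this interval
   has length ln (rho (1 - 1/r)), r = S_i / S_{i-1}, and when rho is below the
   claimed bound it is at most (theta / L) ln r with theta < 1.  Telescoping, a
   single schedule serves times of logarithmic density at most theta / L.  For
   each T exactly sum_{i <= H} C(k, i) of the 2^k answer strings are admissible,
   and all of them must serve T: the densities would add up to at least
   2^k / L, which contradicts theta < 1.  Densities are measured by counting
   points of a geometric progression t q^j. *)

(** Apply [ln x <= x - 1] at [x = (1 - r^-1) (1 + L) / L] and at [x = (1 + L) / r], the latter with
    weight [L^-1]: the right-hand sides cancel. Both points equal 1 at the extremal ratio
    [r = 1 + L], so the bound is sharp. *)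
Lemma ln_contract_ratio_bound (R : realType) (L r : R) : 0 < L -> 1 < r ->
  ln (L^-1 * (1 + L) `^ (1 + L^-1)) + ln (1 - r^-1) <= L^-1 * ln r.
Proof.
move=> L0 r1.
have r0 : 0 < r by lra.
have L1 : 0 < 1 + L by lra.
have Li0 : 0 < L^-1 by rewrite invr_gt0.
have u0 : 0 < r^-1 by rewrite invr_gt0.
have u1 : r^-1 < 1 by rewrite invf_lt1.
have v0 : 0 < 1 - r^-1 by lra.
have ln_le (x : R) : 0 < x -> ln x <= x - 1.
  by move=> x0; rewrite -{1}[x](subrK 1) addrC le_ln1Dx//; lra.
have -> : ln (L^-1 * (1 + L) `^ (1 + L^-1)) = (1 + L^-1) * ln (1 + L) - ln L.
  by rewrite lnM ?posrE ?powR_gt0// ln_powR lnV ?posrE// addrC.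
have h1 : ln (1 - r^-1) + ln (1 + L) - ln L <= (1 - r^-1) * (1 + L) * L^-1 - 1.
  rewrite -lnM ?posrE// -ln_div ?posrE ?mulr_gt0//.
  by apply: ln_le; rewrite !mulr_gt0.
have h2 : ln (1 + L) - ln r <= (1 + L) * r^-1 - 1.
  by rewrite -ln_div ?posrE//; apply: ln_le; rewrite !mulr_gt0.
have h3 := ler_wpM2l (ltW Li0) h2.
have LL : L * L^-1 = 1 by rewrite divff// gt_eqF.
nra.
Qed.

(** Consecutive points differ by the factor [q], so [c > 0] points between [s] and [b] force
    [q ^+ c.-1 <= b / s]. The case [c = 0] stands apart because the logarithm may then be
    negative. *)
Lemma count_geometric (R : realType) (q t s b : R) (n : nat) :
    1 < q -> 0 < t -> 0 < s ->
  let c := (\sum_(j < n) (s <= t * q ^+ j <= b)%R)%N in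
  c = 0%N \/ c%:R * ln q <= ln (q * b / s).
Proof.
move=> q1 t0 s0 c.
have q0 : 0 < q by lra.
(* The first inequality only carries the induction: the next point to be examined is at least
   [s * q ^+ c]. *)
suff [c0|[_ h]] : c = 0%N \/ (s * q ^+ c <= t * q ^+ n /\ s * q ^+ c <= q * b).
  by left.
  right; rewrite mulr_natl -lnXn//.
  have h' : q ^+ c <= q * b / s by rewrite ler_pdivlMr// mulrC.
  by rewrite ler_ln ?posrE ?exprn_gt0// (lt_le_trans _ h')// exprn_gt0.
rewrite {}/c; elim: n => [|n IHn]; first by left; rewrite big_ord0.
rewrite big_ord_recr/=; set c := (\sum_(j < n) _)%N in IHn *.
have tq0 : 0 < t * q ^+ n by rewrite mulr_gt0// exprn_gt0.
have [/andP[sT Tb]|_] := boolP (s <= t * q ^+ n <= b).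
  right; rewrite addn1.
  have sc : s * q ^+ c <= t * q ^+ n by case: IHn => [->|[]//]; rewrite expr0 mulr1.
  rewrite !exprSr !mulrA ler_pM2r// [q * b]mulrC ler_pM2r//; split=> //.
  exact: le_trans Tb.
rewrite addn0; case: IHn => [->|[h1 h2]]; [by left|right; split=> //].
by rewrite exprSr mulrA (le_trans h1)// ler_peMr// ltW.
Qed.

Lemma served_by_schedule (R : realType) (X : schedule R) (q t rho kappa : R) :
    1 < q -> 0 < t -> 0 <= kappa ->
    (forall r, 1 < r -> ln (q * rho * (1 - r^-1)) <= kappa * ln r) ->
  exists C, forall n,
    (\sum_(j < n)
       `[< exists i, (series X i.+1 <= t * q ^+ j <= rho * X i)%R >])%N%:R * ln q
    <= C + kappa * (n%:R * ln q).
Proof.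
move=> q1 t0 k0 key.
have q0 : 0 < q by lra.
have lnq : 0 < ln q by rewrite ln_gt0.
pose S i := series X i.+1.
have SS i : S i.+1 = S i + X i.+1 by rewrite /S /series /= big_nat_recr.
have S00 : S 0%N = X 0%N by rewrite /S /series /= big_nat1.
have S0 i : 0 < S i.
  elim: i => [|i IHi]; first by rewrite S00 contract_gt0.
  by rewrite SS addr_gt0// contract_gt0.
pose c n i := (\sum_(j < n) (S i <= t * q ^+ j <= rho * X i)%R)%N.
have c0 n : (c n 0%N)%:R * ln q <= Num.max 0 (ln (q * rho)).
  have [|] := @count_geometric R q t (S 0%N) (rho * X 0%N) n q1 t0 (S0 0%N).
    by rewrite -/(c n 0%N) => ->; rewrite mul0r le_max lexx.
  rewrite -/(c n 0%N) S00 mulrA mulfK ?gt_eqF ?contract_gt0// => h.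
  by rewrite le_max h orbT.
(* Here [key] is used at [r = S i.+1 / S i], for which [1 - r^-1 = X i.+1 / S i.+1]. *)
have cS n i : (c n i.+1)%:R * ln q <= kappa * (ln (S i.+1) - ln (S i)).
  have Slt : 1 < S i.+1 / S i by rewrite ltr_pdivlMr// mul1r SS ltrDl contract_gt0.
  rewrite -ln_div ?posrE//.
  have [|] := @count_geometric R q t (S i.+1) (rho * X i.+1) n q1 t0 (S0 i.+1).
    by rewrite -/(c n i.+1) => ->; rewrite mul0r mulr_ge0// ltW// ln_gt0.
  move/le_trans; apply; have := key _ Slt; congr (ln _ <= _).
  rewrite invf_div -!mulrA; congr (_ * (_ * _)).
  rewrite -[X in X - _](@divff _ (S i.+1)) ?gt_eqF// -mulrBl; congr (_ / _).
  by rewrite SS addrC addKr.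
(* The maximum pays for the first interval, which has no preceding sum to telescope against; the
   absolute value pays for the ends of the telescoped sum. Neither depends on [n]. *)
exists (Num.max 0 (ln (q * rho)) + kappa * `|ln t - ln (S 0%N)|) => n.
have C1 : 0 <= Num.max 0 (ln (q * rho)) by rewrite le_max lexx.
have lnTn : ln (t * q ^+ n) = ln t + n%:R * ln q.
  by rewrite lnM ?posrE ?exprn_gt0// lnXn// mulr_natl.
set served := (\sum_(_ < _) _)%N.
have served_le m : (forall i, S i <= t * q ^+ n -> (i < m)%N) ->
    (served <= \sum_(i < m) c n i)%N.
  move=> hm; rewrite exchange_big /=; apply: leq_sum => j _.
  case: asboolP => // -[i /andP[h1 h2]].
  have im : (i < m)%N.
    apply: hm; rewrite (le_trans h1)// ler_pM2l// ler_weXn2l// ?ltW//.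
    by apply: ltnW.
  by rewrite (bigD1 (Ordinal im))//= /S h1 h2.
have sum_le m :
    (\sum_(i < m.+1) c n i)%N%:R * ln q <=
    Num.max 0 (ln (q * rho)) + kappa * (ln (S m) - ln (S 0%N)).
  elim: m => [|m IHm]; first by rewrite big_ord1 subrr mulr0 addr0.
  rewrite big_ord_recr/= natrD mulrDl; have := cS n m; lra.
pose P i := S i <= t * q ^+ n.
have [exP|nP] := pselect (exists i, P i); last first.
  suff -> : served = 0%N.
    by rewrite mul0r !addr_ge0// !mulr_ge0// ltW.
  apply/eqP; rewrite -leqn0 (leq_trans (served_le 0%N _)) ?big_ord0//.
  by move=> i Si; case: nP; exists i.
have SX i : i%:R * X 0%N <= S i.
  elim: i => [|i IHi]; first by rewrite mul0r ltW.
  by rewrite -natr1 mulrDl mul1r SS lerD// (contract_incr X).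
have ubP i : P i -> (i <= Num.truncn (t * q ^+ n / X 0%N))%N.
  move=> Pi; have h : i%:R <= t * q ^+ n / X 0%N.
    by rewrite ler_pdivlMr ?contract_gt0// (le_trans (SX i)).
  by rewrite truncn_ge_nat// (le_trans _ h).
(* Contracts after the last [m] with [S m <= t * q ^+ n] serve none of the first [n] points. *)
case: (ex_maxnP exP ubP) => m Pm mmax.
have lnS : ln (S m) <= ln t + n%:R * ln q.
  by rewrite -lnTn ler_ln ?posrE// mulr_gt0// exprn_gt0.
apply: (@le_trans _ _ ((\sum_(i < m.+1) c n i)%N%:R * ln q)).
  rewrite ler_pM2r// ler_nat; apply: served_le => i Pi; rewrite ltnS; exact: mmax.
apply: (le_trans (sum_le m)); rewrite -addrA lerD2l -mulrDr ler_wpM2l//.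
have := ler_norm (ln t - ln (S 0%N)); lra.
Qed.

(* For fixed T, an answer string is determined by the set of its errors, since
   the first j answers determine the next query. *)
Lemma card_admissible (R : realType) (k H : nat) (A : scheme R k) (T : R) :
  #|[pred a : k.-tuple bool | (wrong_answers A T a <= H)%N]| =
  (\sum_(0 <= i < H.+1) 'C(k, i))%N.
Proof.
pose truth (a : seq bool) i := `[< query A (take i a) T >].
pose err (a : k.-tuple bool) := [set i : 'I_k | tnth a i != truth a i]%SET.
have err_inj : injective err.
  move=> a b eab; apply/val_inj.
  have E i : (i <= k)%N -> take i a = take i b.
    elim: i => [|i IHi] ik; first by rewrite !take0.
    rewrite !(take_nth false) ?size_tuple// IHi ?(ltnW ik)//; congr rcons.
    have /setP/(_ (Ordinal ik)) := eab.
    rewrite !inE /truth /= IHi ?(ltnW ik)// !(tnth_nth false) /=.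
    by case: (nth _ a _) (nth _ b _) (asbool _) => [] [] [].
  by have := E k (leqnn k); rewrite !take_oversize ?size_tuple.
(* Answer strings and error sets both number [2 ^ k], so injectivity suffices. *)
have err_bij : bijective err.
  apply: inj_card_bij => //.
  by rewrite card_tuple card_bool -cardsT -powersetT card_powerset cardsT card_ord.
transitivity #|[set s : {set 'I_k} | (#|s| <= H)%N]%SET|.
  rewrite -(on_card_preimset (onW_bij _ err_bij)); apply: eq_card => a.
  by rewrite !inE /wrong_answers cardsE.
(* Sort the error sets by size; [inord] keeps the size intact since only sets of size at most [H]
   are counted. *)
rewrite -sum1_card (partition_big (fun s : {set 'I_k} => inord #|s| : 'I_H.+1) predT)//=.
rewrite big_mkord; apply: eq_bigr => i _.
rewrite sum1_card -[in RHS](card_ord k) -card_draws; apply: eq_card => s.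
rewrite [RHS]inE -[LHS]topredE /= inE; case: leqP => sH.
  by rewrite -val_eqE /= inordK.
by apply/esym/negbTE; rewrite gtn_eqF// (leq_trans (ltn_ord i)).
Qed.

Theorem theorem9 (R : realType) (k H : nat) (hk : (1 <= k)%N) (hH : (H <= k)%N)
    (A : scheme R k) :
  let L : R := 2 ^+ k / \sum_(0 <= i < H.+1) 'C(k, i)%:R in
  ((L^-1 * (1 + L) `^ (1 + L^-1))%:E <= acceleration_ratio H A)%E.
Proof.
lazy zeta; set L := 2 ^+ k / _; set B := L^-1 * _; rewrite leNgt; apply/negP => accB.
pose V := (\sum_(0 <= i < H.+1) 'C(k, i))%N.
have V0 : (0 : R) < V%:R by rewrite ltr0n /V big_nat_recl// bin0.
have LE : L = 2 ^+ k / V%:R by rewrite /L /V natr_sum.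
have L0 : 0 < L by rewrite LE divr_gt0// exprn_gt0.
have B1 : 1 < B.
  have Li0 : 0 < L^-1 by rewrite invr_gt0.
  have : 1 + L <= (1 + L) `^ (1 + L^-1).
    by rewrite -[leLHS]powRr1 ?ler_powR//; lra.
  move/(ler_wpM2l (ltW Li0)); rewrite -/B mulrDr mulVf ?gt_eqF//; lra.
(* Taking the maximum with 1 rules out [-oo], so that [rho] is a real number. *)
have [rho [rho1 rhoB acc_rho]] :
    exists rho, [/\ 1 <= rho, rho < B & (acceleration_ratio H A <= rho%:E)%E].
  have eB : (maxe 1%:E (acceleration_ratio H A) < B%:E)%E.
    by rewrite gt_max lte_fin B1.
  have e1 : (1%:E <= maxe 1%:E (acceleration_ratio H A))%E by rewrite le_max lexx.
  have e2 : (acceleration_ratio H A <= maxe 1%:E (acceleration_ratio H A))%E.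
    by rewrite le_max lexx orbT.
  by case: (maxe _ _) eB e1 e2 => // r; rewrite lte_fin lee_fin; exists r.
have rho0 : 0 < rho by lra.
(* The factor [q] absorbs the rounding in [count_geometric]. *)
pose q := (1 + B / rho) / 2.
have q1 : 1 < q.
  have : 1 < B / rho by rewrite ltr_pdivlMr// mul1r.
  rewrite /q; lra.
have q0 : 0 < q by lra.
have lnq : 0 < ln q by rewrite ln_gt0.
have qrho : q * rho = (rho + B) / 2.
  by rewrite /q mulrAC mulrDl divfK ?gt_eqF// mul1r.
pose theta := ln (q * rho) / ln B.
have lnB : 0 < ln B by rewrite ln_gt0.
have lnqr : 0 < ln (q * rho) by rewrite ln_gt0// qrho; lra.
have lnqrB : ln (q * rho) < ln B by rewrite ltr_ln ?posrE ?qrho; lra.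
have theta0 : 0 < theta by rewrite divr_gt0.
have theta1 : theta < 1 by rewrite ltr_pdivrMr// mul1r.
(* As [ln (1 - r^-1) <= 0] and [theta < 1], scaling this term by [theta] can only increase it; the
   common factor [theta] then comes out. *)
have key r : 1 < r -> ln (q * rho * (1 - r^-1)) <= theta * L^-1 * ln r.
  move=> r1; have ri1 : r^-1 < 1 by rewrite invf_lt1//; lra.
  have ri0 : 0 < r^-1 by rewrite invr_gt0; lra.
  have z0 : ln (1 - r^-1) <= 0 by rewrite ln_le0//; lra.
  rewrite lnM ?posrE; [|by rewrite mulr_gt0|by lra].
  have -> : ln (q * rho) = theta * ln B by rewrite divfK// gt_eqF.
  have := ler_wpM2l (ltW theta0) (@ln_contract_ratio_bound R L r L0 r1).
  rewrite -/B mulrA mulrDr; nra.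
(* Starting the progression here makes every point an interruption time over which the acceleration
   ratio is taken. *)
pose t := max_first_contract H A.
have t0 : 0 < t.
  by rewrite /t; have [[X _ <-] _] := max_first_contractP H A; apply: contract_gt0.
have kappa0 : 0 <= theta * L^-1 by rewrite ltW// divr_gt0.
pose served (a : k.-tuple bool) j :=
  `[< exists i, series (select A a) i.+1 <= t * q ^+ j <= rho * select A a i >].
have /choice[C hC] a := @served_by_schedule R (select A a) q t rho _ q1 t0 kappa0 key.
have admS (a : k.-tuple bool) j :
    (wrong_answers A (t * q ^+ j) a <= H)%N -> served a j.
  move=> wa; apply/asboolP; set T := t * q ^+ j in wa *.
  have : (schedule_ratio (select A a) T <= rho%:E)%E.
    apply: le_trans acc_rho; apply: ereal_sup_ubound; exists T, a; split=> //.
    by rewrite /T ler_peMr ?exprn_ege1 ?(ltW t0) ?(ltW q1).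
  (* A ratio bounded by the real [rho] excludes the branch [+oo], so some contract has been
     completed. *)
  rewrite /schedule_ratio; case: asboolP => // ne.
  have [[i /= Si <-] _] := largest_completedP ne.
  rewrite lee_fin ler_pdivrMr ?contract_gt0// => Ti.
  by exists i; rewrite Si Ti.
(* Double counting: each of the [n] points is served under each of its [V] admissible strings. *)
have count n : (n * V <= \sum_(a : k.-tuple bool) \sum_(j < n) served a j)%N.
  rewrite exchange_big /= -[n in (n * _)%N]card_ord -sum_nat_const.
  apply: leq_sum => j _; rewrite /V -(@card_admissible R k H A (t * q ^+ j)).
  rewrite -sum1_card big_mkcond /=; apply: leq_sum => a _.
  by rewrite inE; case: ifP => // /admS ->.
have bound n : n%:R * (V%:R * ln q * (1 - theta)) <= \sum_a C a.
  have h : (n * V)%:R * ln q <=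
      \sum_(a : k.-tuple bool) (C a + theta * L^-1 * (n%:R * ln q)).
    apply: (@le_trans _ _
        ((\sum_(a : k.-tuple bool) \sum_(j < n) served a j)%N%:R * ln q)).
      by rewrite ler_pM2r// ler_nat.
    by rewrite natr_sum mulr_suml; apply: ler_sum => a _; exact: hC.
  rewrite big_split /= sumr_const card_tuple card_bool in h.
  have E : (theta * L^-1 * (n%:R * ln q)) *+ (2 ^ k) =
      n%:R * (V%:R * ln q * theta).
    rewrite -mulr_natr natrX LE invf_div.
    by field; rewrite expf_neq0// pnatr_eq0.
  rewrite E natrM in h; lra.
have d0 : 0 < V%:R * ln q * (1 - theta) by rewrite !mulr_gt0// subr_gt0.
(* The left side of [bound] grows linearly in [n] while the right side is fixed; this [n] exceeds
   their quotient. *)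
have := bound (Num.truncn (\sum_a C a / (V%:R * ln q * (1 - theta)))).+1.
rewrite -ler_pdivlMr// leNgt => /negP; apply.
by rewrite -mulr_suml truncnS_gt.
Qed.
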